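(* Let $k$ be an algebraically closed field, $R=k[x,y,z]$, and $f\in R$ a reduced form of degree $d+1$, $d\geq 1$, where $\operatorname{char}(k)$ does not divide $d+1$. Suppose that the curve $X=V(f)\subset\mathbb P^2_k$ is singular, and let $e=\operatorname{indeg}(\operatorname{Syz}(J_f))$. Then $$\operatorname{Bour}(X)\leq e^2.$$
   Context: $J_f=(f_x,f_y,f_z)\subset R$ is the gradient ideal. $\operatorname{Syz}(J_f)=\{(a,b,c)\in R^3: af_x+bf_y+cf_z=0\}$ is graded as a submodule of $R^3$ (a syzygy has degree $n$ if its coordinates are forms of degree $n$). For a graded module $M=\bigoplus_{i\ge 0}M_i$, $\operatorname{indeg}(M)=\min\{i: M_i\ne 0\}$. The curve $X$ (or $f$) is a free divisor if $\operatorname{Syz}(J_f)$ is a free $R$-module. Bourbaki degree: let $e=\operatorname{indeg}(\operatorname{Syz}(J_f))$. If $f$ is a free divisor, set $\operatorname{Bour}(X)=0$. Otherwise choose a minimal generator $\epsilon\in\operatorname{Syz}(J_f)$ of degree $e$; the cokernel of $R(-e)\stackrel{\epsilon}{\to}\operatorname{Syz}(J_f)$ is isomorphic, by a degree-zero graded isomorphism, to $I_\epsilon(e-d)$ for a proper homogeneous ideal $I_\epsilon\subset R$ of codimension two, and $\operatorname{Bour}(X):=\deg(R/I_\epsilon)$ (algebraic multiplicity), which does not depend on the choice of $\epsilon$ of degree $e$. *)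

(* Defs.v *)
From HB Require Import structures.
From mathcomp Require Import all_boot all_order all_algebra.
From mathcomp Require Import ring_quotient mpoly.

Set Implicit Arguments.
Unset Strict Implicit.
Unset Printing Implicit Defensive.

Import GRing.Theory.
Local Open Scope ring_scope.

(* Ideals are boolean predicates; [idealr_closed] and [prime_idealr_closed]
   come from [ring_quotient].  [idealr_closed] already excludes the unit
   ideal. *)
Section Codimension.
Variable A : comNzRingType.
Implicit Types I Q : {pred A}.

Definition prime_ideal Q := idealr_closed Q /\ prime_idealr_closed Q.

(* There is a strictly increasing chain Q_0 < ... < Q_n = Q of primes. *)
Fixpoint prime_chain (n : nat) Q : Prop :=
  prime_ideal Q /\
  if n is m.+1 then
    exists Q' : {pred A},
      [/\ {subset Q' <= Q}, ~ {subset Q <= Q'} & prime_chain m Q']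
  else True.

Definition prime_height Q (h : nat) :=
  prime_chain h Q /\ forall n, prime_chain n Q -> (n <= h)%N.

Definition codimension I (c : nat) :=
  (exists Q, [/\ prime_ideal Q, {subset I <= Q} & prime_height Q c]) /\
  (forall Q, prime_ideal Q -> {subset I <= Q} -> prime_chain c Q).

End Codimension.

Section PlaneCurves.
Variable k : fieldType.
Local Notation R := {mpoly k[3]}.
Implicit Types (f p : R) (s : 'rV[R]_3) (M : {pred 'rV[R]_3}) (I : {pred R}).

(* 0 = 0 ^+ 2 * h, hence a reduced form is nonzero. *)
Definition reduced_form f :=
  forall g h : R, f = g ^+ 2 * h -> g \is a GRing.unit.

Definition singular_point f (v : 'I_3 -> k) :=
  [/\ exists i, v i != 0, f.@[v] = 0 & forall i, (f^`M(i)).@[v] = 0].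

Definition singular_curve f := exists v, singular_point f v.

Definition Syz f : {pred 'rV[R]_3} :=
  fun s => \sum_(i < 3) s 0 i * f^`M(i) == 0.

Definition homog_vec (n : nat) s := forall i, s 0 i \is n.-homog.

Definition indeg M (e : nat) :=
  (exists s, [/\ s \in M, homog_vec e s & s != 0]) /\
  (forall n s, s \in M -> homog_vec n s -> s != 0 -> (e <= n)%N).

(* The rows of B form a basis of M.  Finite bases suffice: a free submodule
   of R^3 has rank at most 3. *)
Definition free_module M :=
  exists n (B : 'M[R]_(n, 3)),
    (forall i, row i B \in M) /\
    (forall s, s \in M -> exists! c : 'rV[R]_n, s = c *m B).

Definition free_divisor f := free_module (Syz f).

(* A minimal generator is an element of M outside (x, y, z)M. *)
Definition minimal_generator M s :=
  s \in M /\
  ~ exists t : 'I_3 -> 'rV[R]_3,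
      (forall i, t i \in M) /\ s = \sum_(i < 3) 'X_i *: t i.

Definition homogeneous_ideal I :=
  forall p, p \in I -> forall n, pihomog mdeg n p \in I.

(* Degree-m piece of the Z-graded ring R. *)
Definition homogz (m : int) p : Prop :=
  if m is Posz n then p \is n.-homog else p = 0.

(* phi : M -> I is R-linear and onto with kernel R eps, so it induces
   M / R eps ~= I; it sends M_n into I(a)_n = I_(n + a). *)
Definition graded_coker_iso M eps I (a : int) (phi : 'rV[R]_3 -> R) :=
  [/\ forall s, s \in M -> phi s \in I,
      {in M &, forall s t, phi (s + t) = phi s + phi t} /\
        {in M, forall s (c : R), phi (c *: s) = c * phi s},
      forall p, p \in I -> exists2 s, s \in M & phi s = p,
      {in M, forall s, phi s = 0 <-> exists c : R, s = c *: eps} &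
      forall n s, s \in M -> homog_vec n s -> homogz (n%:Z + a) (phi s)].

Definition bourbaki_ideal (d : nat) f (e : nat) eps I :=
  [/\ idealr_closed I, homogeneous_ideal I, codimension I 2 &
      exists phi, graded_coker_iso (Syz f) eps I (e%:Z - d%:Z) phi].

(* h = dim_k (R / I)_n. *)
Definition hilbert_function I (n h : nat) :=
  exists2 W : {vspace dhomog 3 k n},
    (forall p : dhomog 3 k n, (p \in W) = (mpoly_of_dhomog p \in I)) &
    h = (\dim {:dhomog 3 k n} - \dim W)%N.

Definition hilbert_polynomial I (P : {poly rat}) :=
  exists N, forall n, (N <= n)%N ->
    exists2 h, hilbert_function I n h & P.[n%:R] = h%:R.

(* For R / I of Krull dimension r >= 1, the Hilbert polynomial has degree
   r - 1 and its leading coefficient is m / (r - 1)!. *)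
Definition multiplicity I (m : nat) :=
  exists P : {poly rat},
    [/\ hilbert_polynomial I P, P != 0 &
        m%:R = lead_coef P * (((size P).-1)`!)%:R].

(* Bour(V(f)) = b, for f a form of degree d + 1. *)
Definition bourbaki_degree (d : nat) f (b : nat) :=
  (free_divisor f /\ b = 0%N) \/
  (~ free_divisor f /\
   exists e eps I,
     [/\ indeg (Syz f) e,
         minimal_generator (Syz f) eps /\ homog_vec e eps,
         bourbaki_ideal d f e eps I &
         multiplicity I b]).

End PlaneCurves.

(* Main.v *)
From Stdlib Require Import Classical.
From HB Require Import structures.
Require Import Defs.
From mathcomp Require Import all_boot all_order all_algebra.
From mathcomp Require Import ring_quotient mpoly.
From mathcomp Require Import ring zify.

(* Write eps = (a, b, c) for the syzygy of degree e and K_i for the Koszul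
   syzygies of the partial derivatives.  The combinations
   eps_i K_j - eps_j K_i are multiples of eps, so the Bourbaki map phi sends
   (K_1, K_2, K_3) to a multiple of (a, b, c), and the degrees make the factor
   a nonzero constant: a, b, c lie in the Bourbaki ideal I.  By minimality of e
   they have no common factor, so two of their linear combinations form a
   complete intersection (A, B) of two forms of degree e inside I.  The Koszul
   complex of (A, B) bounds the Hilbert function of R / I by e ^ 2 in degrees
   >= 2 e, so the Hilbert polynomial is a constant <= e ^ 2. *)

Set Implicit Arguments.
Unset Strict Implicit.
Unset Printing Implicit Defensive.

Import GRing.Theory Num.Theory.
Local Open Scope ring_scope.

(** * Gauss's lemma *)

Section Factorial.
Variable D : idomainType.
Implicit Types (a b c p q : D) (s : seq D).

Definition divides a b := exists c, b = a * c.

Definition prime_elt p :=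
  [/\ p != 0, p \isn't a GRing.unit &
      forall a b, divides p (a * b) -> divides p a \/ divides p b].

Lemma divides_mulr p a b : divides p a -> divides p (a * b).
Proof. by case=> c ->; exists (c * b); rewrite mulrA. Qed.

Lemma divides_mull p a b : divides p b -> divides p (a * b).
Proof. by rewrite mulrC; apply: divides_mulr. Qed.

Lemma dividesD p a b : divides p a -> divides p b -> divides p (a + b).
Proof. by move=> [c ->] [c' ->]; exists (c + c'); rewrite mulrDr. Qed.

Lemma dividesN p a : divides p a -> divides p (- a).
Proof. by move=> [c ->]; exists (- c); rewrite mulrN. Qed.

Lemma dividesDr p a b : divides p a -> divides p (a + b) -> divides p b.
Proof.
move=> pa pab; have -> : b = (a + b) + - a by ring.
by apply: dividesD => //; apply: dividesN.
Qed.

Lemma divides_unit p a b :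
  a \is a GRing.unit -> divides p (a * b) -> divides p b.
Proof.
by move=> ua /(divides_mull a^-1); rewrite mulKr.
Qed.

Lemma divides_unit_unit p a :
  a \is a GRing.unit -> divides p a -> p \is a GRing.unit.
Proof. by move=> ua [c ac]; move: ua; rewrite ac unitrM => /andP[]. Qed.

(** The factors are prime elements, not merely irreducible ones, so uniqueness is automatic and
    [factorial_domain] describes unique factorization domains. *)
Definition prime_factorization a u s :=
  [/\ u \is a GRing.unit, (forall p, p \in s -> prime_elt p) &
      a = u * \prod_(p <- s) p].

Definition factors a := exists u s, prime_factorization a u s.

Lemma unit_factors u : u \is a GRing.unit -> factors u.
Proof. by move=> uu; exists u, [::]; split; rewrite ?big_nil ?mulr1. Qed.

Lemma prime_factors p : prime_elt p -> factors p.
Proof.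
move=> pp; exists 1, [:: p]; split; rewrite ?unitr1 ?big_seq1 ?mul1r //.
by move=> q; rewrite inE => /eqP ->.
Qed.

Lemma mul_factors a b : factors a -> factors b -> factors (a * b).
Proof.
move=> [u [s [uu ps ->]]] [v [t [uv pt ->]]]; exists (u * v), (s ++ t); split.
- by rewrite unitrM uu.
- by move=> p; rewrite mem_cat => /orP[/ps|/pt].
- by rewrite big_cat /=; ring.
Qed.

Lemma prime_divides_prod p s :
  prime_elt p -> divides p (\prod_(q <- s) q) ->
  exists2 q, q \in s & divides p q.
Proof.
move=> pp; elim: s => [|q s IHs].
  rewrite big_nil => /(divides_unit_unit (unitr1 _)) up.
  by case: pp; rewrite up.
rewrite big_cons; case: (pp) => _ _ P /P[pq | /IHs[r rs pr]].
  by exists q; rewrite ?mem_head.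
by exists r; rewrite // inE rs orbT.
Qed.

(** Write q = p w. If q divided w, then p would be a unit, so the prime q divides p. *)
Lemma prime_divides_prime p q :
  prime_elt p -> prime_elt q -> divides p q -> divides q p.
Proof.
move=> [_ nup _] [nzq _ Pq] [w qw].
have /Pq[//|[w' ww']] : divides q (p * w) by exists 1; rewrite mulr1.
case/negP: nup; apply/unitrP; exists w'.
suff e : p * w' = 1 by rewrite mulrC e.
by apply: (mulfI nzq); rewrite mulr1 {2}qw ww'; ring.
Qed.

(** The primes of a are removed one at a time: each divides b c but not b, hence divides c. *)
Lemma divides_cancel a b c u s :
  prime_factorization a u s -> (forall p, p \in s -> ~ divides p b) ->
  divides a (b * c) -> divides a c.
Proof.
move=> [uu ps ->] {a} nb.
suff : divides (\prod_(p <- s) p) (b * c) -> divides (\prod_(p <- s) p) c.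
  move=> H [w bw]; case: H => [|w' ->].
    by exists (u * w); rewrite bw; ring.
  by exists (u^-1 * w'); rewrite -{1}(mulVKr uu w'); ring.
elim: s ps nb c => [|p s IHs] ps nb c.
  by exists c; rewrite big_nil mul1r.
rewrite big_cons => -[w bw].
have [nzp _ Pp] := ps _ (mem_head _ _).
have /Pp[/nb|[c' cc']] : divides p (b * c).
  by exists (\prod_(q <- s) q * w); rewrite mulrA.
  by rewrite mem_head; case.
case: (IHs _ _ c') => [q qs|q qs||w' c'w'].
- by apply: ps; rewrite inE qs orbT.
- by apply: nb; rewrite inE qs orbT.
- exists w; apply: (mulfI nzp); move: bw; rewrite cc' => e.
  by transitivity (b * (p * c')); [ring|rewrite e; ring].
- by exists w'; rewrite cc' c'w' mulrA.
Qed.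

End Factorial.

Definition factorial_domain (D : idomainType) :=
  forall a : D, a != 0 -> factors a.

(** * Transport of unique factorization along a ring isomorphism *)

Section FactorialTransfer.
Variables (D E : idomainType) (f : {rmorphism D -> E}) (g : E -> D).
Hypotheses (fK : cancel f g) (gK : cancel g f).

Lemma morph_inv_M a b : g (a * b) = g a * g b.
Proof. by apply: (can_inj fK); rewrite rmorphM /= !gK. Qed.

Lemma morph_inv_unit a : (g a \is a GRing.unit) = (a \is a GRing.unit).
Proof.
apply/idP/idP => [/(rmorph_unit f)|/unitrP[b [ba ab]]]; first by rewrite /= gK.
by apply/unitrP; exists (g b); rewrite -!morph_inv_M ab ba -(rmorph1 f) fK.
Qed.

Lemma factorial_iso : factorial_domain E -> factorial_domain D.
Proof.
move=> facE a nza; have [|u [s [uu ps fa]]] := facE (f a).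
  by rewrite -(rmorph0 f) (can_eq fK).
exists (g u), (map g s); split; first by rewrite morph_inv_unit.
  move=> _ /mapP[p /ps[nzp nup Pp] ->]; split.
  - by apply: contraNneq nzp => e; rewrite -[p]gK e rmorph0.
  - by rewrite morph_inv_unit.
  - move=> b c [w bcw]; have /Pp : divides p (f b * f c).
      by exists (f w); rewrite -rmorphM bcw rmorphM /= gK.
    by case=> -[v e]; [left|right]; exists (g v);
      rewrite -morph_inv_M -e fK.
rewrite -[LHS]fK fa morph_inv_M big_map; congr (_ * _).
elim: s {ps fa} => [|p s IHs]; rewrite ?big_nil ?big_cons.
  by rewrite -(rmorph1 f) fK.
by rewrite morph_inv_M IHs.
Qed.

End FactorialTransfer.

(** * Unique factorization in univariate polynomial rings *)

Section GaussLemma.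
Variable D : idomainType.
Hypothesis facD : factorial_domain D.
Implicit Types (p q : D) (f g h : {poly D}).

(** Induction on the sum of the sizes of g and h. The prime p divides the product of the constant
    terms, hence one of them; that term is dropped and the factor divided by ['X]. *)
Lemma polyC_prime p : prime_elt p -> prime_elt p%:P.
Proof.
move=> [nzp nup Pp]; split; first by rewrite polyC_eq0.
  by rewrite poly_unitE size_polyC nzp coefC eqxx.
have pX g : divides p%:P (g * 'X) -> divides p%:P g.
  case=> w gw; exists (\poly_(i < size w) w`_i.+1); apply/polyP => i.
  have /(congr1 (fun r : {poly D} => r`_i.+1)) := gw.
  rewrite coefMX coefCM /= => ->; rewrite coefCM coef_poly.
  case: ltnP => // le_w; rewrite (nth_default 0 (leqW le_w)) //.
pose n g h := (size g + size h)%N.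
move=> g h; have [m le_m] := ubnP (n g h); elim: m g h le_m => // m IHm g h.
elim/poly_ind: g => [|g c _]; first by left; exists 0; rewrite mulr0.
elim/poly_ind: h => [|h d _]; first by right; exists 0; rewrite mulr0.
move=> le_m pgh.
have pcd : divides p (c * d).
  case: pgh => w /(congr1 (fun r : {poly D} => r.[0])).
  rewrite !hornerE /= => e; exists w.[0]; rewrite -e.
  by ring.
(* One side of the argument, where p divides the constant term e; the other side follows by
   commutativity. *)
have step g1 h1 e : divides p e -> (g1 * 'X + e%:P == 0) || (n g1 h1 < m)%N ->
    divides p%:P ((g1 * 'X + e%:P) * h1) ->
    divides p%:P (g1 * 'X + e%:P) \/ divides p%:P h1.
  move=> [e' pe] /orP[/eqP-> _|lt_m]; first by left; exists 0; rewrite mulr0.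
  have pE : divides p%:P e%:P by exists e'%:P; rewrite pe polyCM.
  rewrite mulrDl => pgh1; have /pX/IHm[//|pg|] : divides p%:P (g1 * h1 * 'X).
  - rewrite mulrAC; apply: dividesDr (divides_mulr h1 pE) _; by rewrite addrC.
  - by left; apply: dividesD pE; apply: divides_mulr.
  - by right.
move: le_m; rewrite /n !size_MXaddC => le_m.
case/Pp: pcd => [pc|pd].
  apply: step => //; rewrite -size_poly_eq0 size_MXaddC.
  move: le_m; rewrite /n size_MXaddC; case: ifP => //= _; case: ifP => _; lia.
rewrite or_comm; apply: step => //; last by rewrite mulrC.
rewrite -size_poly_eq0 size_MXaddC.
move: le_m; rewrite /n size_MXaddC; case: ifP => //= _; case: ifP => //= _; lia.
Qed.

Lemma polyC_divides_lead p f : divides p%:P f -> divides p (lead_coef f).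
Proof. by case=> w ->; exists (lead_coef w); rewrite lead_coefM lead_coefC. Qed.

Lemma polyC_factors (a : D) : a != 0 -> factors a%:P.
Proof.
move=> /facD[u [s [uu ps ->]]]; rewrite polyCM; apply: mul_factors.
  by apply: unit_factors; rewrite rmorph_unit.
elim: s ps => [|p s IHs] ps.
  by rewrite big_nil; apply/unit_factors/unitr1.
rewrite big_cons polyCM; apply: mul_factors.
  by apply/prime_factors/polyC_prime/ps; rewrite mem_head.
by apply: IHs => q qs; apply: ps; rewrite inE qs orbT.
Qed.

(* Any factorization over the fraction field rescales to one over D. *)
Lemma polyC_split (c : D) f (q r : {poly D}) :
  c != 0 -> c%:P * f = q * r ->
  exists c1 c2 (q0 r0 : {poly D}),
    [/\ c1 * c2 = c, f = q0 * r0, q = c1%:P * q0 & r = c2%:P * r0].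
Proof.
move=> /facD[u [s [uu ps ->]]].
elim: s ps f q r => [|p s IHs] ps f q r.
  rewrite big_nil mulr1 => e; exists u, 1, (u^-1%:P * q), r; split.
  - by rewrite mulr1.
  - by rewrite -mulrA -e mulrA -polyCM mulVr // mul1r.
  - by rewrite mulrA -polyCM divrr // mul1r.
  - by rewrite mul1r.
rewrite big_cons mulrCA => e.
have pp := ps _ (mem_head _ _); have [nzp _ _] := pp.
have nzpP : p%:P != 0 by rewrite polyC_eq0.
have {}IHs := IHs (fun x xs => ps x (mem_behead (s := p :: s) xs)).
have [_ _ Pp] := polyC_prime pp.
(* The prime p divides q or r; it is cancelled there and charged to the matching constant, [c1] or
   [c2]. *)
have /Pp[[q' qe]|[r' re]] : divides p%:P (q * r).
- by exists ((u * \prod_(j <- s) j)%:P * f); rewrite -e polyCM mulrA.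
- case: (IHs f q' r) => [|c1 [c2 [q0 [r0 [ec ef eq er]]]]].
  + by apply: (mulfI nzpP); rewrite !mulrA -polyCM e qe.
  by exists (p * c1), c2, q0, r0; split; rewrite // ?polyCM -mulrA ?ec -?eq.
- case: (IHs f q r') => [|c1 [c2 [q0 [r0 [ec ef eq er]]]]].
  + by apply: (mulfI nzpP); rewrite !mulrA -polyCM e re; ring.
  exists c1, (p * c2), q0, r0; split=> //; first by rewrite -ec mulrCA.
  by rewrite polyCM -mulrA -er.
Qed.

(** If D is a field it has no primes and even 0 is primitive, whence the separate hypotheses f != 0
    below. *)
Definition primitive f := forall p, prime_elt p -> ~ divides p%:P f.

Lemma primitive_const f (c : D) :
  f != 0 -> primitive f -> divides c%:P f -> c \is a GRing.unit.
Proof.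
move=> nzf prf cf; have nzc : c != 0.
  by apply: contra_neq nzf => c0; case: cf => w ->; rewrite c0 mul0r.
have [u [[|p s] [uu ps ec]]] := facD nzc; first by rewrite ec big_nil mulr1.
case: (prf p (ps p (mem_head _ _))); case: cf => w ->; rewrite ec big_cons.
by exists ((u * \prod_(j <- s) j)%:P * w); rewrite !polyCM; ring.
Qed.

(** When c = c1 c2 is split between f and the cofactor, c1 divides the primitive f, hence is a
    unit. *)
Lemma primitive_cancel f g (c : D) :
  f != 0 -> primitive f -> c != 0 -> divides f (c%:P * g) -> divides f g.
Proof.
move=> nzf prf nzc [w /(polyC_split nzc)[c1 [c2 [f0 [w0 [_ -> ef _]]]]]].
have uc1 : c1 \is a GRing.unit.
  by apply: (primitive_const nzf prf); exists f0.
by exists (c1^-1%:P * w0); rewrite ef mulrACA -polyCM mulrV // mul1r.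
Qed.

Lemma factor_out_content f : f != 0 ->
  exists (c : D) g, [/\ c != 0, primitive g & f = c%:P * g].
Proof.
move=> nzf; have [u [s [uu ps]]] : factors (lead_coef f).
  by apply: facD; rewrite lead_coef_eq0.
move=> /(congr1 ( *%R u^-1)); rewrite mulKr // mulrC => /esym es.
(* A list of primes whose product is a multiple of the leading coefficient bounds how many primes
   can be taken out of f: each one taken out uses up an associated member of the list. *)
have {u uu es} : divides (lead_coef f) (\prod_(p <- s) p) by exists u^-1.
have [n] := ubnP (size s); elim: n s f nzf ps => // n IHn s f nzf ps.
rewrite ltnS => les ef.
have [prf|nprf] := classic (primitive f).
  by exists 1, f; split; rewrite ?oner_eq0 ?mul1r.
have [p np] := not_all_ex_not _ _ nprf.
have [pp /NNPP pf] := imply_to_and _ _ np.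
have [w pw] := polyC_divides_lead pf; have [v ev] := ef.
have [q qs pq] : exists2 q, q \in s & divides p q.
  by apply: prime_divides_prod => //; exists (w * v); rewrite mulrA -pw.
have [r er] := prime_divides_prime pp (ps _ qs) pq.
have [nzq _ _] := ps _ qs; case: pf => f1 ff1.
have nzf1 : f1 != 0 by apply: contra_neq nzf => f10; rewrite ff1 f10 mulr0.
have [||c [g [nzc prg eg]]] :=
    IHn (rem q s) f1 nzf1 (fun x xs => ps x (mem_rem xs)).
- by rewrite size_rem //; case: (s) qs les.
- exists (r * v); apply: (mulfI nzq).
  move: ev; rewrite (big_rem q) //= => ->.
  by rewrite ff1 lead_coefM lead_coefC er; ring.
exists (p * c), g; split=> //; last by rewrite polyCM -mulrA -eg ff1.
by rewrite mulf_neq0 //; case: pp.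
Qed.

(** Take r of least size among the nonzero combinations of f and g. Pseudo-division by r leaves a
    remainder that is again a combination, hence zero; c is the power of the leading coefficient of
    r that pseudo-division introduces. *)
Lemma ideal_generator_upto f g : f != 0 ->
  exists r (u v : {poly D}), [/\ r != 0, r = u * f + v * g &
    forall h, h = f \/ h = g -> exists2 c : D, c != 0 & divides r (c%:P * h)].
Proof.
move=> nzf.
pose I r := r != 0 /\ exists u v, r = u * f + v * g.
have [r [nzr [u [v er]]] minr] :
    exists2 r, I r & forall r', I r' -> (size r <= size r')%N.
  have [r0 Ir0] : exists r, I r by exists f; split=> //; exists 1, 0; ring.
  have [n] := ubnP (size r0); elim: n r0 Ir0 => // n IHn r Ir le_r.
  have [minr|nminr] := classic (forall r', I r' -> (size r <= size r')%N).
    by exists r.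
  have [r' nr'] := not_all_ex_not _ _ nminr.
  have [Ir' /negP] := imply_to_and _ _ nr'; rewrite -ltnNge => lt_r.
  by apply: (IHn r' Ir'); lia.
exists r, u, v; split=> // h hfg.
exists (lead_coef r ^+ scalp h r); first by rewrite expf_neq0 ?lead_coef_eq0.
exists (h %/ r); have := Pdiv.Idomain.divp_eq h r.
have [->|nz_rem] := eqVneq (h %% r) 0; first by rewrite addr0 mul_polyC mulrC.
rewrite -mul_polyC => eh; suff /minr : I (h %% r).
  by rewrite leqNgt ltn_modp nzr.
split=> //; rewrite -[h %% r](addKr (h %/ r * r)) -eh er.
set c := _%:P; set w := _ %/ _.
by case: hfg => ->; [exists (c - w * u), (- w * v) |
  exists (- w * u), (c - w * v)]; ring.
Qed.

(* Let r be a generator, up to constants, of the ideal (f, g) over the fraction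
   field.  Either r is constant and f | r h, or r is associated to f and
   f | c g; in both cases the constant cancels because f is primitive. *)
Lemma irreducible_prime f : primitive f -> (1 < size f)%N ->
  (forall g h, f = g * h -> size g = 1%N \/ size h = 1%N) -> prime_elt f.
Proof.
move=> prf gt1 irr; have nzf : f != 0 by rewrite -size_poly_gt0; lia.
split=> //.
  by rewrite poly_unitE; apply/negP => /andP[/eqP e]; rewrite e in gt1.
move=> g h fgh; have [r [u [v [nzr er rP]]]] := ideal_generator_upto g nzf.
have [c nzc [q]] := rP f (or_introl erefl).
move=> /(polyC_split nzc)[c1 [c2 [r0 [q0 [ec ef e1 e2]]]]].
have nzc1 : c1 != 0 by apply: contra_neq nzc; rewrite -ec => ->; rewrite mul0r.
have [s1|s1] := irr _ _ ef.
  right; have /size_poly1P[x nzx ex] : size r == 1%N.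
    by rewrite e1 size_Cmul // s1.
  apply: (primitive_cancel nzf prf nzx); rewrite -ex er mulrDl.
  apply: dividesD.
    by apply: divides_mulr; apply: divides_mull; exists 1; rewrite mulr1.
  by rewrite -mulrA; apply: divides_mull.
left; have /size_poly1P[x nzx ex] : size q0 == 1%N by rewrite s1.
have ux : x \is a GRing.unit.
  by apply: (primitive_const nzf prf); exists r0; rewrite -ex mulrC.
have [c' nzc' [q' eq']] := rP g (or_intror erefl).
apply: (primitive_cancel nzf prf nzc'); rewrite eq' e1; apply: divides_mulr.
apply: divides_mull; exists (x^-1%:P).
by rewrite ef ex -mulrA -polyCM mulrV // mulr1.
Qed.

(** Induction on the size. The content factors in D; the primitive part is a unit, a prime by
    [irreducible_prime], or a product of two factors of smaller size. *)
Lemma factorial_poly : factorial_domain {poly D}.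
Proof.
move=> f; have [n] := ubnP (size f); elim: n f => // n IHn f le_f.
move=> /[dup] nzf /factor_out_content[c [g [nzc prg ef]]].
rewrite ef; apply: mul_factors; first exact: polyC_factors.
have nzg : g != 0 by apply: contra_neq nzf => g0; rewrite ef g0 mulr0.
rewrite ef size_Cmul // in le_f; have [le1|gt1] := leqP (size g) 1.
  have [x ex] : exists x, g = x%:P by exists g`_0; apply: size1_polyC.
  apply: unit_factors; rewrite ex rmorph_unit //.
  by apply: (primitive_const nzg prg); exists 1; rewrite mulr1.
have [irr|nirr] := classic
  (forall h1 h2, g = h1 * h2 -> size h1 = 1%N \/ size h2 = 1%N).
  by apply/prime_factors/irreducible_prime.
have [h1 nirr1] := not_all_ex_not _ _ nirr.
have [h2 nirr2] := not_all_ex_not _ _ nirr1.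
have [eg /not_or_and[s1 s2]] := imply_to_and _ _ nirr2.
have [nz1 nz2] : h1 != 0 /\ h2 != 0.
  by apply/andP; rewrite -negb_or -mulf_eq0 -eg.
have := size_mul nz1 nz2; rewrite -eg => es.
move: nz1 nz2; rewrite eg -!size_poly_gt0 => nz1 nz2.
by apply: mul_factors; apply: IHn; rewrite -?size_poly_gt0 //; lia.
Qed.
End GaussLemma.

(** * Polynomials in n + 1 variables as univariate polynomials in the last one; [mpoly_of_poly]
    inverts [muni] *)

Definition mpoly_of_poly (R : comNzRingType) n (q : {poly {mpoly R[n]}}) :
    {mpoly R[n.+1]} :=
  (map_poly (@mwiden n R) q).['X_ord_max].

Lemma mpoly_of_polyD (R : comNzRingType) n :
  {morph @mpoly_of_poly R n : p q / p + q}.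
Proof. by move=> p q; rewrite /mpoly_of_poly rmorphD hornerD. Qed.

Lemma muniX (R : comNzRingType) n (m : 'X_{1..n.+1}) :
  muni 'X_[m] =
  'X_[[multinom m (widen_ord (leqnSn n) i) | i < n]] *: 'X^(m ord_max)
    :> {poly {mpoly R[n]}}.
Proof. by rewrite muniE msuppX big_seq1 mcoeffX eqxx scale1r. Qed.

Lemma muniK (R : comNzRingType) n : cancel (@muni n R) (@mpoly_of_poly R n).
Proof.
elim/mpolyind => [|c m p _ _ IHp].
  by rewrite raddf0 /mpoly_of_poly rmorph0 horner0.
rewrite muniD mpoly_of_polyD IHp muniZ muniX; congr (_ + _).
rewrite /mpoly_of_poly -!mul_polyC !rmorphM /= !map_polyC map_polyXn /=.
rewrite !hornerM !hornerC hornerXn mwidenC mwidenX.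
rewrite -mul_mpolyC; congr (_ * _).
rewrite mpolyXn -mpolyXD; congr 'X_[_]; apply/mnmP => i.
rewrite mnmDE mulmnE mnm1E; case: (unliftP ord_max i) => [j|] ->.
  have -> : lift ord_max j = widen_ord (leqnSn n) j.
    by apply: val_inj; rewrite /= /bump leqNgt ltn_ord.
  by rewrite mnmwiden_widen mnmE -val_eqE /= gtn_eqF // addn0.
by rewrite mnmwiden_ordmax eqxx mul1n.
Qed.

Lemma muni_widen (R : comNzRingType) n (p : {mpoly R[n]}) :
  muni (mwiden p) = p%:P.
Proof.
elim/mpolyind: p => [|c m p _ _ IHp]; first by rewrite !raddf0.
rewrite mwidenD mwidenZ mwidenX muniD muniZ muniX IHp polyCD; congr (_ + _).
rewrite mnmwiden_ordmax expr0 -mul_polyC -mul_mpolyC polyCM; congr (_ * _).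
rewrite -mul_polyC mulr1; congr (_%:P); congr 'X_[_].
by apply/mnmP => i; rewrite mnmE mnmwiden_widen.
Qed.

Lemma mpoly_of_polyK (R : comNzRingType) n :
  cancel (@mpoly_of_poly R n) (@muni n R).
Proof.
elim/poly_ind => [|p c IHp].
  by rewrite /mpoly_of_poly rmorph0 horner0 raddf0.
rewrite mpoly_of_polyD muniD {2}/mpoly_of_poly map_polyC hornerC muni_widen.
congr (_ + _); rewrite /mpoly_of_poly rmorphM /= map_polyX hornerMX rmorphM /=.
rewrite -/(mpoly_of_poly p) IHp muniX mnm1E eqxx expr1 -mul_polyC.
congr (_ * _).
rewrite (_ : [multinom _ | i < n] = 0%MM) ?mpolyX0 ?mul1r //.
by apply/mnmP => i; rewrite !mnmE -val_eqE /= gtn_eqF.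
Qed.

Lemma factorial_mpoly (F : fieldType) n : factorial_domain {mpoly F[n]}.
Proof.
elim: n => [|n IHn].
  move=> p nzp; apply: unit_factors.
  have ep : p = (p@_0)%:MP.
    apply/mpolyP => m; rewrite mcoeffC (_ : m = 0%MM) ?eqxx ?mulr1 //.
    by apply/mnmP => -[].
  move: nzp; rewrite ep mpolyC_eq0 => nzp.
  by rewrite rmorph_unit // unitfE.
exact: factorial_iso (@muniK F n) (@mpoly_of_polyK F n) (factorial_poly IHn).
Qed.

(** * Syzygies of the partial derivatives *)

Lemma closed_field_infinite (k : closedFieldType) (T : seq k) :
  exists t, t \notin T.
Proof.
have [t] : exists t, ~~ root (\prod_(a <- T) ('X - a%:P)) t.
  by apply/closed_nonrootP/monic_neq0/monic_prod_XsubC.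
by rewrite root_prod_XsubC; exists t.
Qed.

(* A prime divides b + t c for at most one scalar t. *)
Lemma avoid_primes (k : closedFieldType) n (s : seq {mpoly k[n]})
    (b c : {mpoly k[n]}) :
  (forall p, p \in s -> ~ (divides p b /\ divides p c)) ->
  exists t : k, forall p, p \in s -> ~ divides p (b + t *: c).
Proof.
move=> ns; suff [T bad] : exists T : seq k, forall t, t \notin T ->
    forall p, p \in s -> ~ divides p (b + t *: c).
  by have [t /bad] := closed_field_infinite T; exists t.
elim: s ns => [|p s IHs] ns; first by exists [::].
have [q qs|T HT] := IHs; first by apply: ns; rewrite inE qs orbT.
have [[t0 pt0]|np] := classic (exists t0 : k, divides p (b + t0 *: c));
  last first.
  exists T => t /HT H q; rewrite inE => /orP[/eqP->|/H//] pt.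
  by apply: np; exists t.
exists (t0 :: T) => t; rewrite inE negb_or => /andP[nt /HT H] q.
rewrite inE => /orP[/eqP-> {q H} pt|/H//].
have pc : divides p c.
  have u : (t - t0)%:MP_[n] \is a GRing.unit.
    by rewrite rmorph_unit // unitfE subr_eq0.
  apply: (divides_unit u); rewrite mul_mpolyC.
  have -> : (t - t0) *: c = (b + t *: c) - (b + t0 *: c).
    by rewrite scalerBl; ring.
  by apply: dividesD pt _; apply: dividesN.
apply: (ns p (mem_head _ _)); split=> //.
apply: dividesDr (_ : divides p (t *: c)) _; last by rewrite addrC.
by rewrite -mul_mpolyC; apply: divides_mull.
Qed.

(** * Homogeneous components *)

Section Homogeneous.
Variables (n : nat) (R : idomainType).
Implicit Types (p q f : {mpoly R[n]}).

Lemma mderiv_homog d f i : f \is (d.+1).-homog -> f^`M(i) \is d.-homog.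
Proof.
move=> /dhomogP hf; rewrite /mderiv big_seq rpred_sum // => m mf.
have [->|nz] := eqVneq (m i) 0%N; first by rewrite mul0r scale0r rpred0.
apply: rpredZ; rewrite dhomogX; have := hf _ mf.
have le1 : (U_(i) <= m)%MM by rewrite lep1mP.
by rewrite -{1}(submK le1) /= mdegD mdeg1 addn1 => -[->].
Qed.

Lemma pihomogMr m d p q :
  q \is d.-homog -> pihomog mdeg (m + d)%N (p * q) = pihomog mdeg m p * q.
Proof.
move=> hq; pose K := maxn (msize p) m.+1.
have lepK : (mmeasure mdeg p <= K)%N by rewrite leq_maxl.
rewrite {1}[p](pihomog_partitionE lepK) mulr_suml linear_sum /=.
have ltmK : (m < K)%N by rewrite leq_maxr.
rewrite (bigD1 (Ordinal ltmK)) //= big1 ?addr0 => [|i nim].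
  by rewrite pihomog_dE //; apply: dhomogM => //; apply: pihomogP.
apply: (@pihomog_ne0 _ _ mdeg (i + d)%N); first by rewrite eqn_add2r.
by apply: dhomogM => //; apply: pihomogP.
Qed.

Lemma dhomog_msizeE d p : p \is d.-homog -> p != 0 -> msize p = d.+1.
Proof.
by move=> /dhomogP hp nzp; rewrite -mlead_deg // (hp _ (mlead_supp nzp)).
Qed.

Lemma pihomog_neq0 p : p != 0 ->
  exists2 m, (m < msize p)%N & pihomog mdeg m p != 0.
Proof.
move=> nzp; have [/existsP[m nzm]|] :=
  boolP [exists m : 'I_(msize p), pihomog mdeg m p != 0]; first by exists m.
rewrite negb_exists => /forallP z; case/eqP: nzp.
rewrite [LHS](pihomog_partitionE (leqnn (mmeasure mdeg p))) big1 // => m _.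
by apply/eqP/negPn/z.
Qed.

End Homogeneous.

Lemma rV_neq0_coord (V : nmodType) n (v : 'rV[V]_n) :
  v != 0 -> exists i, v 0 i != 0.
Proof.
move=> nzv; apply/existsP; rewrite -negb_forall.
apply: contra nzv => /forallP z.
by apply/eqP/rowP => i; rewrite mxE; apply/eqP.
Qed.

(** * The syzygy of least degree and the Koszul syzygies *)

Section Syzygies.
Variables (k : fieldType) (d : nat) (f : {mpoly k[3]}).
Hypothesis f_form : f \is (d.+1).-homog.

(** Dividing eps by a common prime gives a syzygy w of smaller degree. Homogeneous components of w
    are again syzygies, so a nonzero one contradicts the minimality of e. *)
Lemma indeg_coprime e (eps : 'rV_3) (p : {mpoly k[3]}) :
  indeg (Syz f) e -> eps \in Syz f -> homog_vec e eps -> eps != 0 ->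
  prime_elt p -> ~ (forall i, divides p (eps 0 i)).
Proof.
move=> [_ mine] /eqP sye he nze [nzp nup _] pe.
have [w ew] : exists w : 'I_3 -> {mpoly k[3]}, forall i, eps 0 i = p * w i.
  by apply: (fin_all_exists (P := fun i c => eps 0 i = p * c)).
have syw : \sum_(i < 3) w i * f^`M(i) = 0.
  apply: (mulfI nzp); rewrite mulr0 -[RHS]sye mulr_sumr.
  by apply: eq_bigr => i _; rewrite ew mulrA.
have [i nzi] := rV_neq0_coord nze.
have nzw : w i != 0 by apply: contra_neq nzi => wi0; rewrite ew wi0 mulr0.
have [m ltm nzm] := pihomog_neq0 nzw.
have : (e <= m)%N.
  apply: (mine m (\row_j pihomog mdeg m (w j))).
  - apply/eqP; have := congr1 (pihomog mdeg (m + d)%N) syw.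
    rewrite linear0 linear_sum /= => pi0; rewrite -[RHS]pi0.
    by apply: eq_bigr => j _; rewrite mxE pihomogMr //; apply: mderiv_homog.
  - by move=> j; rewrite mxE pihomogP.
  - apply: contra_neq nzm => /rowP/(_ i); by rewrite !mxE.
have := dhomog_msizeE (he i) nzi; rewrite ew msizeM //.
(* [msize] is the degree plus one: a nonunit p has positive degree, so [w i] has degree below e. *)
have : (1 < msize p)%N.
  rewrite ltnNge; apply: contra nup => /msize1_polyC ep.
  by rewrite ep rmorph_unit // unitfE; move: nzp; rewrite {1}ep mpolyC_eq0.
by move: ltm; move: (mmeasure _ p) (mmeasure _ (w i)) => a b; lia.
Qed.

(* Up to sign, the cross product of the i-th unit vector with the gradient of
   f; indices in 'I_3 are added modulo 3. *)
Definition koszul (i : 'I_3) : 'rV[{mpoly k[3]}]_3 :=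
  \row_j (if j == i + 1 then f^`M(i + 2)
          else if j == i + 2 then - f^`M(i + 1) else 0).

Lemma koszul_Syz i : koszul i \in Syz f.
Proof.
(* Indexing by natural numbers lets [ring] identify equal indices whose bound proofs differ. *)
apply/eqP; pose G m := f^`M(inord m).
rewrite (eq_bigr (fun j => koszul i 0 j * G j)); last first.
  by move=> j _; rewrite /G inord_val.
have kE j : koszul i 0 j = if j == i + 1 then G (i + 2)
    else if j == i + 2 then - G (i + 1) else 0.
  by rewrite mxE /G !inord_val.
rewrite !big_ord_recl big_ord0 !kE.
case: i {kE} => -[|[|[|//]]] lt3 /=; ring.
Qed.

Lemma koszul_homog i : homog_vec d (koszul i).
Proof.
move=> j; rewrite mxE; case: ifP => _; first exact: mderiv_homog.
by case: ifP => _; rewrite ?rpredN ?rpred0 // mderiv_homog.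
Qed.

(** Up to sign the left side is (u x eps) x grad f, with u the unit vector of the third index l. The
    triple product formula gives f_l eps - (eps . grad f) u, and the last term vanishes since eps is
    a syzygy. *)
Lemma koszul_minor (eps : 'rV_3) i j : eps \in Syz f ->
  exists c, eps 0 i *: koszul j - eps 0 j *: koszul i = c *: eps.
Proof.
move=> /eqP; pose G m := f^`M(inord m); pose E m := eps 0 (inord m).
rewrite !big_ord_recl big_ord0 => sy.
exists (if j == i + 1 then - G (i + 2)
        else if j == i + 2 then G (i + 1) else 0).
apply/rowP => l; rewrite !mxE.
have eE x : eps 0 x = E x by rewrite /E inord_val.
have fE x : f^`M(x) = G x by rewrite /G inord_val.
move: sy; rewrite !eE !fE; set S := _ + _ => S0.
(* Each coordinate is an identity, either outright or up to plus or minus the relation S = 0. *)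
have addS x y : x - y = S -> x = y by rewrite S0 => /subr0_eq.
have subS x y : y - x = S -> x = y by rewrite S0 => /subr0_eq.
rewrite /S in addS subS; move: {S S0} addS subS.
case: i => -[|[|[|//]]] lti; case: j => -[|[|[|//]]] ltj;
  case: l => -[|[|[|//]]] ltl /= addS subS;
  first [ring | apply: addS; ring | apply: subS; ring].
Qed.

End Syzygies.

(** * Hilbert functions *)

Section CompleteIntersection.
Variables (k : fieldType) (e : nat) (A B : {mpoly k[3]}).
Variable I : {pred {mpoly k[3]}}.
Hypotheses (hA : A \is e.-homog) (hB : B \is e.-homog) (nzA : A != 0).
(** B is a nonzerodivisor modulo A, which makes the Koszul complex of (A, B) exact in the middle. *)
Hypothesis copAB : forall v, divides A (B * v) -> divides A v.
Hypotheses (idI : idealr_closed I) (AI : A \in I) (BI : B \in I).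

Lemma idealr_closed_mul p c : p \in I -> c * p \in I.
Proof. by case: idI => I0 _ IM pI; rewrite -[c * p]addr0; apply: IM. Qed.

Lemma idealr_closed_add p q : p \in I -> q \in I -> p + q \in I.
Proof. by case: idI => _ _ IM pI qI; rewrite -[p]mul1r; apply: IM. Qed.

Definition dhomog_mul (C : {mpoly k[3]}) (hC : C \is e.-homog) m
    (p : dhomog 3 k m) : dhomog 3 k (m + e) :=
  DHomog (dhomogM (dhomog_is_dhomog p) hC).

(** [koszul_map] followed by [pair_map] is the Koszul complex of (A, B) in fixed degree. *)
Definition pair_map m (u : dhomog 3 k m * dhomog 3 k m) : dhomog 3 k (m + e) :=
  dhomog_mul hA u.1 + dhomog_mul hB u.2.

Definition koszul_map m (w : dhomog 3 k m) :
    dhomog 3 k (m + e) * dhomog 3 k (m + e) :=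
  (dhomog_mul hB w, - dhomog_mul hA w).

Lemma pair_map_linear m : linear (@pair_map m).
Proof. by move=> a u v; apply/val_inj => /=; rewrite -!mul_mpolyC; ring. Qed.

Lemma koszul_map_linear m : linear (@koszul_map m).
Proof.
by move=> a u v; congr pair; apply/val_inj => /=; rewrite -!mul_mpolyC; ring.
Qed.

HB.instance Definition _ m :=
  GRing.isLinear.Build k _ _ _ _ (@pair_map_linear m).
HB.instance Definition _ m :=
  GRing.isLinear.Build k _ _ _ _ (@koszul_map_linear m).

Lemma ker_pair_map m :
  (lker (linfun (@pair_map (m + e))) <= limg (linfun (@koszul_map m)))%VS.
Proof.
apply/subvP => -[u1 u2]; rewrite memv_ker lfunE => /eqP/(congr1 val) /= e0.
have Bu2 : B * u2 = A * - (u1 : {mpoly k[3]}).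
  by apply/eqP; rewrite -subr_eq0; apply/eqP; rewrite -[RHS]e0; ring.
have [c ec] : divides A (u2 : {mpoly k[3]}).
  by apply: copAB; exists (- mpoly_of_dhomog u1).
(* The quotient c may be replaced by its component of degree m, since A and u2 are forms. *)
have {}ec : u2 = A * pihomog mdeg m c :> {mpoly k[3]}.
  rewrite mulrC -(pihomogMr _ _ hA) [c * A]mulrC -ec pihomog_dE //.
  exact: dhomog_is_dhomog.
have hc : - pihomog mdeg m c \is m.-homog by rewrite rpredN pihomogP.
apply/memv_imgP; exists (DHomog hc); first exact: memvf.
rewrite lfunE; congr pair; apply/val_inj => /=; last by rewrite ec; ring.
by apply: (mulfI nzA); rewrite -[LHS]opprK -mulrN -Bu2 ec; ring.
Qed.

Lemma dim_dhomog n : (2 * \dim {:dhomog 3 k n} = (n + 2) * (n + 1))%N.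
Proof.
rewrite dimvf.
have -> : dim (dhomog 3 k n) = 'C(n + 2, n) by [].
rewrite -bin_sub ?leq_addr // addKn.
have := bin_ffact (n + 2) 2; rewrite !ffactnS ffactn0 (_ : 2`! = 2)%N //; nia.
Qed.

(** Let D(n) be the dimension of the forms of degree n = m + 2e. By [ker_pair_map], (A, B) fills at
    least 2 D(m + e) - D(m) dimensions of I in degree n, so h is at most the second difference D(m +
    2e) - 2 D(m + e) + D(m) = e ^ 2. *)
Lemma hilbert_function_le n h :
  (2 * e <= n)%N -> hilbert_function I n h -> (h <= e ^ 2)%N.
Proof.
move=> le_n [W WI ->]; have [m en] : exists m, n = (m + e + e)%N.
  by exists (n - 2 * e)%N; lia.
subst n.
have sub : (limg (linfun (@pair_map (m + e))) <= W)%VS.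
  apply/subvP => _ /memv_imgP[u _ ->]; rewrite WI lfunE /=.
  by apply: idealr_closed_add; apply: idealr_closed_mul.
have := dimvS sub.
have := limg_ker_dim (linfun (@pair_map (m + e))) fullv.
have := dimvS (ker_pair_map m).
have := limg_ker_dim (linfun (@koszul_map m)) fullv.
rewrite !capfv.
have -> : \dim {: (dhomog 3 k (m + e) * dhomog 3 k (m + e))%type} =
    (\dim {:dhomog 3 k (m + e)} + \dim {:dhomog 3 k (m + e)})%N.
  by rewrite !dimvf.
have := dim_dhomog m; have := dim_dhomog (m + e).
have := dim_dhomog (m + e + e).
rewrite -mulnn => dim2 dim1 dim0 dimK leK dimf leW.
rewrite leq_subLR -(leq_pmul2l (isT : (0 < 2)%N)) mulnDr dim2.
move: dim1 dim0 dimK leK dimf leW.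
move: (\dim {:dhomog 3 k (m+e)}) (\dim {:dhomog 3 k m}) => x y.
move: (\dim (lker _)) (\dim (lker _)) (\dim (limg _)) (\dim (limg _)).
move: (\dim W) => w a b c c'.
lia.
Qed.

End CompleteIntersection.

(** The product of the P - c over all c <= E vanishes at every large integer, hence is zero, and so
    is one of its factors. *)
Lemma bounded_hilbert_polynomial (P : {poly rat}) N E :
  (forall n, (N <= n)%N -> exists2 h, (h <= E)%N & P.[n%:R] = h%:R) ->
  exists2 c, (c <= E)%N & P = c%:R%:P.
Proof.
move=> HP; pose Q := \prod_(c < E.+1) (P - c%:R%:P).
have Q0 : Q = 0.
  apply/eqP/negPn/negP => nzQ.
  pose s : seq rat := [seq n%:R | n <- iota N (size Q)].
  have us : uniq s.
    rewrite map_inj_uniq ?iota_uniq // => x y /eqP.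
    by rewrite eqr_nat => /eqP.
  have rs : all (root Q) s.
    apply/allP => x /mapP[n]; rewrite mem_iota => /andP[len _] ->{x}.
    have [h leh eh] := HP n len.
    rewrite /root horner_prod (bigD1 (Ordinal (leh : (h < E.+1)%N))) //=.
    by rewrite !hornerE eh subrr mul0r.
  by have := max_poly_roots nzQ rs us; rewrite size_map size_iota ltnn.
have /eqP/prodf_eq0[c _] := Q0; rewrite subr_eq0 => /eqP ec.
by exists c; rewrite // -ltnS.
Qed.

(** * The Bourbaki ideal *)

Lemma ord3_cases (i j : 'I_3) : [\/ j = i, j = i + 1 | j = i + 2].
Proof.
case: i j => -[|[|[|//]]] lti [[|[|[|//]]] ltj];
  by [constructor 1; apply/val_inj | constructor 2; apply/val_inj
     | constructor 3; apply/val_inj].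
Qed.

Lemma SyzD (k : fieldType) (f : {mpoly k[3]}) (s t : 'rV_3) :
  s \in Syz f -> t \in Syz f -> s + t \in Syz f.
Proof.
move=> /eqP s0 /eqP t0; apply/eqP.
under eq_bigr => i _ do rewrite mxE mulrDl.
by rewrite big_split /= s0 t0 addr0.
Qed.

Lemma SyzZ (k : fieldType) (f : {mpoly k[3]}) (c : {mpoly k[3]}) (s : 'rV_3) :
  s \in Syz f -> c *: s \in Syz f.
Proof.
move=> /eqP s0; apply/eqP.
under eq_bigr => i _ do rewrite mxE -mulrA.
by rewrite -mulr_sumr s0 mulr0.
Qed.

Section BourbakiIdeal.
Variables (k : closedFieldType) (d : nat) (f : {mpoly k[3]}).
Hypothesis f_form : f \is (d.+1).-homog.
Variables (e : nat) (eps : 'rV[{mpoly k[3]}]_3).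
Hypotheses (e_indeg : indeg (Syz f) e) (eps_Syz : eps \in Syz f).
Hypotheses (eps_homog : homog_vec e eps) (eps_neq0 : eps != 0).

(** By [indeg_coprime], no prime factor of [eps 0 i] divides both other coordinates, so
    [avoid_primes] yields a combination of them that is coprime to [eps 0 i]. *)
Lemma coprime_combination i : eps 0 i != 0 ->
  exists t : k, forall v,
    divides (eps 0 i) ((eps 0 (i + 1) + t *: eps 0 (i + 2)) * v) ->
    divides (eps 0 i) v.
Proof.
move=> nzi; have [u [s [uu ps es]]] := factorial_mpoly nzi.
have [p sp|t Ht] :=
    avoid_primes (s := s) (b := eps 0 (i + 1)) (c := eps 0 (i + 2)).
  move=> [p1 p2].
  apply: (indeg_coprime f_form e_indeg eps_Syz eps_homog eps_neq0 (ps p sp)).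
  have p0 : divides p (eps 0 i).
    rewrite es; apply: divides_mull.
    by rewrite (big_rem p) //=; apply: divides_mulr; exists 1; rewrite mulr1.
  by move=> j; case: (ord3_cases i j) => ->.
by exists t => v; apply: (divides_cancel (u := u) (s := s)).
Qed.

Variables (I : {pred {mpoly k[3]}}) (phi : 'rV[{mpoly k[3]}]_3 -> {mpoly k[3]}).
Hypothesis idI : idealr_closed I.
Hypothesis phi_iso : graded_coker_iso (Syz f) eps I (e%:Z - d%:Z) phi.

Lemma phi_koszul_homog i : phi (koszul f i) \is e.-homog.
Proof.
case: phi_iso => _ _ _ _ /(_ d _ (koszul_Syz f i) (koszul_homog f_form i)).
by rewrite addrC subrK.
Qed.

(** The combination in [koszul_minor] is a multiple of eps, hence is killed by phi: the images of
    the Koszul syzygies are proportional to eps. *)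
Lemma phi_koszul_minor i j :
  eps 0 i * phi (koszul f j) = eps 0 j * phi (koszul f i).
Proof.
case: phi_iso => _ [phiD phiZ] _ phi0 _.
have [c ec] := koszul_minor i j eps_Syz.
have kS l : koszul f l \in Syz f := koszul_Syz f l.
have ZS (c' : {mpoly k[3]}) l : c' *: koszul f l \in Syz f := SyzZ c' (kS l).
have [_] := phi0 _ (SyzD (ZS (eps 0 i) j) (ZS (- eps 0 j) i)).
rewrite phiD // !phiZ // mulNr => e0; apply/subr0_eq/e0.
by exists c; rewrite scaleNr.
Qed.

(** Otherwise K_i = c eps. The i-th coordinate of K_i is 0, so c = 0 and the two partials in K_i
    vanish; the relation for eps then kills the third, and the syzygy module is all of R^3, which is
    free. *)
Lemma phi_koszul_neq0 i :
  ~ free_divisor f -> eps 0 i != 0 -> phi (koszul f i) != 0.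
Proof.
move=> f_nonfree nzi; case: phi_iso => _ _ _ phi0 _.
apply/eqP => /(phi0 _ (koszul_Syz f i))[c Kc].
have c0 : c = 0.
  apply: (mulIf nzi); move/rowP/(_ i): Kc; rewrite !mxE mul0r => <-.
  by case: i {nzi} => -[|[|[|//]]].
have {Kc} K0 j : koszul f i 0 j = 0 by rewrite Kc c0 scale0r mxE.
have f1 : f^`M(i + 1) = 0.
  apply/eqP; rewrite -oppr_eq0; apply/eqP; have := K0 (i + 2); rewrite mxE.
  by case: (i) => -[|[|[|//]]].
have f2 : f^`M(i + 2) = 0 by have := K0 (i + 1); rewrite mxE eqxx.
have f0 : f^`M(i) = 0.
  apply: (mulfI nzi); rewrite mulr0 -(eqP eps_Syz) (bigD1 i) //= big1 ?addr0 //.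
  by move=> j; case: (ord3_cases i j) => ->; rewrite ?eqxx ?f1 ?f2 // mulr0.
have fj j : f^`M(j) = 0 by case: (ord3_cases i j) => ->.
case: f_nonfree; exists 3, 1%:M; split.
  by move=> j; apply/eqP; rewrite big1 // => l _; rewrite fj mulr0.
by move=> s _; exists s; split; rewrite ?mulmx1 // => s' ->; rewrite mulmx1.
Qed.

Lemma eps_in_ideal i : ~ free_divisor f -> eps 0 i \in I.
Proof.
move=> f_nonfree; have [i0 nz0] := rV_neq0_coord eps_neq0.
have [t cop] := coprime_combination nz0.
have nza := phi_koszul_neq0 f_nonfree nz0.
have [h ah] : divides (eps 0 i0) (phi (koszul f i0)).
  (* Proportionality turns the combination times phi(K_i0) into [eps 0 i0] times the same
     combination of the other images. *)
  apply: cop; exists (phi (koszul f (i0 + 1)) + t *: phi (koszul f (i0 + 2))).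
  rewrite -!mul_mpolyC mulrDl -mulrA.
  rewrite -(phi_koszul_minor i0) -(phi_koszul_minor i0 (i0 + 2)).
  by ring.
have nzh : h != 0 by apply: contra_neq nza => h0; rewrite ah h0 mulr0.
(* Both [phi (koszul f i0)] and [eps 0 i0] have degree e, so their quotient h is constant. *)
have eh : h = (h@_0)%:MP.
  apply: msize1_polyC; have := dhomog_msizeE (phi_koszul_homog i0) nza.
  rewrite ah msizeM // (dhomog_msizeE (eps_homog i0) nz0).
  by move: (mmeasure _ h) => n; lia.
have aj : phi (koszul f i) = eps 0 i * h.
  by apply: (mulfI nz0); rewrite phi_koszul_minor ah; ring.
have uh : h \is a GRing.unit.
  by rewrite eh rmorph_unit // unitfE -(mpolyC_eq0 3) -eh.
have [phiI _ _ _ _] := phi_iso.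
rewrite -[eps 0 i](mulrK uh) -aj mulrC.
exact: idealr_closed_mul (phiI _ (koszul_Syz f i)).
Qed.

End BourbakiIdeal.

(** * The bound on the Bourbaki degree *)

Theorem theorem2p10 (k : closedFieldType) (d : nat) (f : {mpoly k[3]})
    (d_ge1 : (1 <= d)%N)
    (f_form : f \is (d.+1).-homog)
    (f_reduced : reduced_form f)
    (char_k : forall p : nat, p \in [pchar k] -> ~~ (p %| d.+1)%N)
    (X_singular : singular_curve f)
    (e : nat) (e_indeg : indeg (Syz f) e)
    (b : nat) (b_Bour : bourbaki_degree d f b) :
  (b <= e ^ 2)%N.
Proof.
case: b_Bour => [[_ ->] //|[nfree [e' [eps [I]]]]].
move=> [e'_indeg [min_eps eps_homog]] [idI _ _ [phi phi_iso]].
move=> [P [[N HP] nzP mP]].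
have ee' : e' = e.
  apply/eqP; rewrite eqn_leq.
  have [[s [sS hs nzs]] mine] := e_indeg.
  have [[s' [sS' hs' nzs']] mine'] := e'_indeg.
  by rewrite (mine' _ _ sS hs nzs) (mine _ _ sS' hs' nzs').
subst e'; have [eps_Syz not_dec] := min_eps.
(* The zero syzygy lies in (x, y, z) Syz, so it is not a minimal generator. *)
have nze : eps != 0.
  apply/eqP => eps0; case: not_dec; exists (fun=> 0).
  split=> [_|]; last by rewrite eps0 big1 // => i _; rewrite scaler0.
  by rewrite -eps0.
have epsI i :=
  eps_in_ideal f_form e_indeg eps_Syz eps_homog nze idI phi_iso i nfree.
have [i0 nz0] := rV_neq0_coord nze.
have [t cop] := coprime_combination f_form e_indeg eps_Syz eps_homog nze nz0.
have hB : eps 0 (i0 + 1) + t *: eps 0 (i0 + 2) \is e.-homog.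
  by rewrite rpredD ?rpredZ ?eps_homog.
have BI : eps 0 (i0 + 1) + t *: eps 0 (i0 + 2) \in I.
  by rewrite -mul_mpolyC;
    exact: idealr_closed_add (epsI _) (idealr_closed_mul idI _ (epsI _)).
have bound := hilbert_function_le (eps_homog i0) hB nz0 cop idI (epsI i0) BI.
have [c le_c eP] : exists2 c, (c <= e ^ 2)%N & P = c%:R%:P.
  apply: (@bounded_hilbert_polynomial _ (maxn N (2 * e))) => n.
  rewrite geq_max => /andP[/HP[h hh eh] le_n].
  by exists h => //; apply: bound hh.
(* P is a nonzero constant c, so the factorial is 0! = 1 and the multiplicity is c itself. *)
move: mP nzP; rewrite eP polyC_eq0 => mP nzc.
rewrite lead_coefC size_polyC nzc /= mulr1 in mP.
by move/eqP: mP; rewrite eqr_nat => /eqP->.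
Qed.
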